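(* Let $R$ be a local ring and let $s\in R$ be central. Then $A\in K_s(R)$ is strongly $J^{\#}$-clean in $K_s(R)$ if and only if one of the following three statements holds: (1) $A\in J^{\#}(K_s(R))$; (2) $A\in I+J^{\#}(K_s(R))$, where $I$ is the identity of $K_s(R)$; (3) $A\sim \begin{bmatrix} a & 0\\ 0 & b\end{bmatrix}$ for some $a,b\in R$ such that one of $a,b$ is in $J(R)$ and the other is in $1+J(R)$.
   Context: All rings are associative with identity, not necessarily commutative; a ring $R$ is local if it has a unique maximal left ideal. $J(R)$ denotes the Jacobson radical of $R$, and $J^{\#}(R)=\{z\in R : z^n\in J(R)\text{ for some } n\ge 1\}$. An element $a$ of a ring $R$ is strongly $J^{\#}$-clean if $a=e+j$ with $e^2=e\in R$, $j\in J^{\#}(R)$ and $ej=je$. For a ring $R$ and a central element $s\in R$, $K_s(R)$ denotes the ring whose elements are the $2\times 2$ matrices with entries in $R$, with entrywise addition and multiplication $$\begin{bmatrix} a & b\\ c& d\end{bmatrix}\begin{bmatrix} a' & b'\\ c'& d'\end{bmatrix}=\begin{bmatrix} aa'+sbc' & ab'+bd'\\ ca'+dc' & scb'+dd'\end{bmatrix}.$$ Its identity is $I=\begin{bmatrix}1&0\\0&1\end{bmatrix}$. For $A,B\in K_s(R)$, $A\sim B$ means that $B=PAP^{-1}$ for some unit $P$ of $K_s(R)$. *)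

(* Defs.v *)
From HB Require Import structures.
From mathcomp Require Import all_boot all_algebra.
From mathcomp Require Import boolp classical_sets.

Set Implicit Arguments.
Unset Strict Implicit.
Unset Printing Implicit Defensive.

Import GRing.Theory.
Local Open Scope ring_scope.
Local Open Scope classical_set_scope.

Section Rings.
Variable R : pzRingType.

Definition central (s : R) : Prop := forall x : R, GRing.comm s x.

Definition left_ideal (I : set R) : Prop :=
  [/\ I 0, forall x y, I x -> I y -> I (x + y) & forall a x, I x -> I (a * x)].

Definition maximal_left_ideal (M : set R) : Prop :=
  [/\ left_ideal M, M <> setT
    & forall I, left_ideal I -> M `<=` I -> I = M \/ I = setT].

Definition local_ring : Prop := exists! M : set R, maximal_left_ideal M.

Definition jacobson : set R := \bigcap_(M in maximal_left_ideal) M.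

Definition jsharp : set R :=
  [set z | exists2 n : nat, (1 <= n)%N & jacobson (z ^+ n)].

Definition strongly_jsharp_clean (a : R) : Prop :=
  exists e j : R, [/\ a = e + j, e ^+ 2 = e, jsharp j & e * j = j * e].

(* Q is the inverse of the unit P; a pzRingType has no inverse operation *)
Definition ring_similar (A B : R) : Prop :=
  exists P Q : R, [/\ P * Q = 1, Q * P = 1 & B = P * A * Q].

End Rings.

Arguments jacobson : clear implicits.
Arguments jsharp : clear implicits.
Arguments local_ring : clear implicits.

(* The ring K_s(R).  The carrier and the additive structure are those of
   'M[R]_2, but the alias is given its own product below, so on Kmx hs the
   operation * is the s-twisted product and not *m.  Centrality of s, which
   associativity requires, is a parameter of the type. *)
Definition Kmx (R : pzRingType) (s : R) (hs : central s) : Type := 'M[R]_2.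

Section KmxRing.
Variables (R : pzRingType) (s : R) (hs : central s).

HB.instance Definition _ := GRing.Zmodule.copy (Kmx hs) 'M[R]_2.

(* the matrix with rows (a, b) and (c, d) *)
Definition mkK (a b c d : R) : Kmx hs :=
  \matrix_(i < 2, j < 2)
    if i == 0 then (if j == 0 then a else b) else (if j == 0 then c else d).

Definition Kone : Kmx hs := mkK 1 0 0 1.

Definition Kmul (A B : Kmx hs) : Kmx hs :=
  mkK (A 0 0 * B 0 0 + s * A 0 1 * B 1 0) (A 0 0 * B 0 1 + A 0 1 * B 1 1)
      (A 1 0 * B 0 0 + A 1 1 * B 1 0) (s * A 1 0 * B 0 1 + A 1 1 * B 1 1).

Lemma mkKE a b c d : (mkK a b c d 0 0 = a) * (mkK a b c d 0 1 = b) *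
  (mkK a b c d 1 0 = c) * (mkK a b c d 1 1 = d).
Proof. by rewrite !mxE. Qed.

Lemma KmxP (A B : Kmx hs) :
  [/\ A 0 0 = B 0 0, A 0 1 = B 0 1, A 1 0 = B 1 0 & A 1 1 = B 1 1] -> A = B.
Proof.
have I2 (i : 'I_2) : i = 0 \/ i = 1.
  by case: i => [[|[|//]] ?]; [left|right]; apply: val_inj.
case=> E1 E2 E3 E4; apply/matrixP=> i j.
by case: (I2 i) => ->; case: (I2 j) => ->.
Qed.

Lemma KaddE (A B : Kmx hs) i j : (A + B) i j = A i j + B i j.
Proof. exact: mxE. Qed.

Let scomm x y : x * (s * y) = s * (x * y).
Proof. by rewrite mulrA -hs -mulrA. Qed.

Lemma KmulA : associative Kmul.
Proof.
move=> A B C; apply: KmxP; rewrite !mkKE !(mulrDl, mulrDr) -!mulrA !scomm.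
by split; rewrite -!addrA; congr (_ + _); rewrite addrCA addrA addrC addrA.
Qed.

Lemma Kmul1l : left_id Kone Kmul.
Proof.
by move=> A; apply: KmxP; rewrite !mkKE !(mulr0, mul0r, mul1r, addr0, add0r).
Qed.

Lemma Kmul1r : right_id Kone Kmul.
Proof.
by move=> A; apply: KmxP; rewrite !mkKE !(mulr0, mul0r, mulr1, addr0, add0r).
Qed.

Lemma KmulDl : left_distributive Kmul +%R.
Proof.
by move=> A B C; apply: KmxP; rewrite !(KaddE, mkKE) !(mulrDr, mulrDl);
  split; rewrite addrACA.
Qed.

Lemma KmulDr : right_distributive Kmul +%R.
Proof.
by move=> A B C; apply: KmxP; rewrite !(KaddE, mkKE) !mulrDr;
  split; rewrite addrACA.
Qed.

HB.instance Definition _ := GRing.Zmodule_isPzRing.Build (Kmx hs)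
  KmulA Kmul1l Kmul1r KmulDl KmulDr.

Lemma mkK1 : mkK 1 0 0 1 = 1.
Proof. by []. Qed.

Lemma mkKD a b c d a' b' c' d' : mkK a b c d + mkK a' b' c' d' =
  mkK (a + a') (b + b') (c + c') (d + d').
Proof. by apply: KmxP; rewrite !(KaddE, mkKE). Qed.

Lemma mkKM a b c d a' b' c' d' : mkK a b c d * mkK a' b' c' d' =
  mkK (a * a' + s * b * c') (a * b' + b * d')
      (c * a' + d * c') (s * c * b' + d * d').
Proof. by rewrite [LHS]/GRing.mul /= /Kmul !mkKE. Qed.

End KmxRing.

(* Main.v *)
Require Import Defs.
From mathcomp Require Import all_boot all_algebra.
From mathcomp Require Import boolp classical_sets.

(** Why the theorem holds.  The Jacobson radical is the set of those [z] for
which every [1 - y * z] has a left inverse ([jacobsonP]); hence it is a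
two-sided ideal stable under conjugation.  In a local ring an element outside
the radical is invertible, so one of [x], [1 - x] always is.

Suppose [A = e + j] is a strongly clean decomposition.  The only thing to
understand is the idempotent [e] of [K_s(R)], and the claim is that it is [0],
[1], or similar to one of the two diagonal matrix units
([local_Kmx_idempotent]).  Replacing [e] by [1 - e] if necessary, its upper
left entry is invertible, and elimination leaves a Schur complement [t].  If
[t] is invertible then so is [e], whence [e = 1].  Otherwise [1 - t] is
invertible, and [1 - t] turns out to be the Schur complement of
[e * f + (1 - e) * (1 - f)], where [f] is the first diagonal unit; this matrix
always intertwines [e] and [f], so once it is invertible [e] and [f] are
similar.

When [e = 0] or [e = 1] the first or second alternative is the decomposition
itself.  When [e] is conjugate to a diagonal unit, the conjugate of [j]
commutes with that unit and so is diagonal; a power of it lies in the radical,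
which forces both entries into [J(R)] ([jacobson_diagP], [local_jsharp]), and
the third alternative follows.  Conversely a diagonal matrix as in the third
alternative is a diagonal unit plus a diagonal matrix over [J(R)], which lies
in the radical of [K_s(R)] by the same description, and clean decompositions
can be conjugated. *)

Set Implicit Arguments.
Unset Strict Implicit.
Unset Printing Implicit Defensive.

Import GRing.Theory.
Local Open Scope ring_scope.
Local Open Scope classical_set_scope.

(** * The Jacobson radical of an arbitrary ring *)

Section Radical.
Variable R : pzRingType.
Implicit Types (I M : set R) (x y z : R).

Definition invertible x := exists y, x * y = 1 /\ y * x = 1.

Lemma invertibleM x y : invertible x -> invertible y -> invertible (x * y).
Proof.
move=> [x' [xx' x'x]] [y' [yy' y'y]]; exists (y' * x'); split.
  by rewrite mulrA -(mulrA x) yy' mulr1.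
by rewrite mulrA -(mulrA y') x'x mulr1.
Qed.

Lemma left_ideal_setT I : left_ideal I -> I 1 -> I = setT.
Proof.
move=> [_ _ IM] I1; apply/seteqP; split=> // x _.
by rewrite -[x]mulr1; exact: IM.
Qed.

Lemma maximal_left_ideal1 M : maximal_left_ideal M -> ~ M 1.
Proof. by case=> idM MT _ M1; apply: MT; exact: left_ideal_setT. Qed.

Lemma left_ideal_principal x : left_ideal (range (fun w => w * x)).
Proof.
split.
- by exists 0; rewrite ?mul0r.
- by move=> _ _ [u _ <-] [v _ <-]; exists (u + v); rewrite ?mulrDl.
- by move=> a _ [u _ <-]; exists (a * u); rewrite ?mulrA.
Qed.

(** Zorn's lemma is applied to the sets [X] for which [X `|` I], rather than
[X] itself, is a proper left ideal: the empty chain then has an upper bound. *)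
Lemma left_ideal_sub_maximal I : left_ideal I -> ~ I 1 ->
  exists2 M, maximal_left_ideal M & I `<=` M.
Proof.
move=> idI I1.
pose P (X : set R) := left_ideal (X `|` I) /\ ~ (X `|` I) 1.
have chainP (F : set (set R)) : F `<=` P -> total_on F subset ->
    P (\bigcup_(X in F) X).
  move=> FP Ftot; case: (idI) => I0 ID IM; split; last first.
    by case=> [[X FX X1]|//]; case: (FP _ FX) => _; apply; left.
  split; first by right.
  - have step (X : set R) x y : F X -> (X `|` I) x -> (X `|` I) y ->
        ((\bigcup_(Y in F) Y) `|` I) (x + y).
      move=> FX Xx Xy; case: (FP _ FX) => -[_ XD _] _.
      by case: (XD _ _ Xx Xy) => [Xxy|]; [left; exists X | right].
    move=> x y [[X FX Xx]|Ix] [[Y FY Yy]|Iy]; last by right; exact: ID.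
    + by have [XY|YX] := Ftot _ _ FX FY;
        [apply: (step Y) | apply: (step X)] => //; left; auto.
    + by apply: (step X) => //; [left | right].
    + by apply: (step Y) => //; [right | left].
  - move=> a x [[X FX Xx]|Ix]; last by right; exact: IM.
    case: (FP _ FX) => -[_ _ XM] _.
    have [|Xax|] := XM a x; [by left | by left; exists X | by right].
have [X [[idX X1] Xmax]] := Zorn_bigcup chainP.
exists (X `|` I); last by move=> x Ix; right.
split=> // [XT|N idN subN]; first by apply: X1; rewrite XT.
have [N1|N1] := pselect (N 1); first by right; exact: left_ideal_setT.
left; apply/seteqP; split=> //.
have NI : N `|` I = N by apply/setUidPl => x Ix; apply: subN; right.
have [NX|NX] := pselect (N `<=` X); first by move=> x /NX; left.
case: (Xmax N); last by split; rewrite NI.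
by split=> // x Xx; apply: subN; left.
Qed.

Lemma left_ideal_jacobson : left_ideal (jacobson R).
Proof.
split.
- by move=> M [[]].
- by move=> x y Jx Jy M maxM; case: (maxM) => -[_ MD _] _ _;
    apply: MD; [exact: Jx | exact: Jy].
- by move=> a x Jx M maxM; case: (maxM) => -[_ _ MM] _ _; apply: MM; exact: Jx.
Qed.

Lemma jacobsonD x y : jacobson R x -> jacobson R y -> jacobson R (x + y).
Proof. by case: left_ideal_jacobson => _ + _; apply. Qed.

Lemma jacobsonMl a x : jacobson R x -> jacobson R (a * x).
Proof. by case: left_ideal_jacobson => _ _; apply. Qed.

Lemma jacobsonN x : jacobson R x -> jacobson R (- x).
Proof. by rewrite -mulN1r; exact: jacobsonMl. Qed.

(** If [1 - y * z] is not left invertible, a maximal left ideal containing it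
misses [z]; if a maximal left ideal misses [z], it together with [R * z]
generates [1], so it contains some [1 - y * z]. *)
Lemma jacobsonP z :
  jacobson R z <-> forall y, exists w, w * (1 - y * z) = 1.
Proof.
split=> [Jz y|linv M maxM].
  apply: contrapT => nlinv.
  have [|M maxM subM] := left_ideal_sub_maximal (left_ideal_principal (1 - y * z)).
    by move=> [w _ ww]; apply: nlinv; exists w.
  case: (maxM) => -[_ MD MM] _ _; apply: (maximal_left_ideal1 maxM).
  rewrite -(subrK (y * z) 1); apply: MD.
    by apply: subM; exists 1; rewrite ?mul1r.
  by apply: MM; exact: Jz.
apply: contrapT => nMz; case: (maxM) => -[M0 MD MM] _ Mmax.
pose N := [set x | exists m y, M m /\ x = m + y * z].
have idN : left_ideal N.
  split; first by exists 0, 0; rewrite mul0r addr0.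
  - move=> _ _ [m [y [Mm ->]]] [m' [y' [Mm' ->]]].
    by exists (m + m'), (y + y'); rewrite mulrDl addrACA; split=> //; exact: MD.
  - move=> a _ [m [y [Mm ->]]].
    by exists (a * m), (a * y); rewrite mulrDr mulrA; split=> //; exact: MM.
have subN : M `<=` N by move=> m Mm; exists m, 0; rewrite mul0r addr0.
case: (Mmax N idN subN) => [NM|NT].
  by apply: nMz; rewrite -NM; exists 0, 1; rewrite mul1r add0r.
have [m [y [Mm m1]]] : N 1 by rewrite NT.
have [w ww] := linv y; apply: (maximal_left_ideal1 maxM).
by rewrite -ww m1 addrK; exact: MM.
Qed.

(** The radical is also a right ideal, because a left inverse [w] of
[1 - r * x] gives the left inverse [1 + x * w * r] of [1 - x * r]. *)
Lemma jacobsonMr r x : jacobson R x -> jacobson R (x * r).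
Proof.
move=> /jacobsonP Jx; apply/jacobsonP => y; have [w ww] := Jx (r * y).
exists (1 + y * x * w * r).
rewrite mulrDl mul1r mulrBr mulr1.
have -> : y * x * w * r * (y * (x * r)) = y * x * (w * (r * y * x)) * r.
  by rewrite !mulrA.
have -> : w * (r * y * x) = w - 1.
  by apply/eqP; rewrite -ww mulrBr mulr1 subKr.
by rewrite mulrBr mulr1 mulrBl subKr !mulrA subrK.
Qed.

(** A left inverse [w] of [1 - z] satisfies [w = 1 + w * z], so it is itself left
invertible, and its left inverse can only be [1 - z]. *)
Lemma jacobson_invertible z : jacobson R z -> invertible (1 - z).
Proof.
move=> /jacobsonP Jz; have [w ww] := Jz 1; rewrite mul1r in ww.
have wE : w = 1 - - w * z.
  by rewrite mulNr opprK -ww mulrBr mulr1 subrK.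
have [v vw] := Jz (- w); rewrite -wE in vw.
exists w; split=> //.
have vE : v = 1 - z.
  by have := congr1 ( *%R v) ww; rewrite mulrA vw mul1r mulr1.
by rewrite -vE vw.
Qed.

End Radical.

(** * Similarity *)

Section Similarity.
Variable R : pzRingType.
Implicit Types a b e f j p q x : R.

Lemma conjX p q x n : p * q = 1 -> q * p = 1 ->
  (p * x * q) ^+ n = p * x ^+ n * q.
Proof.
move=> pq qp; elim: n => [|n IHn]; first by rewrite !expr0 mulr1.
by rewrite !exprS IHn !mulrA -(mulrA (p * x)) qp mulr1.
Qed.

Lemma conjM p q a b : q * p = 1 -> p * a * q * (p * b * q) = p * (a * b) * q.
Proof. by move=> qp; rewrite !mulrA -(mulrA (p * a)) qp mulr1. Qed.

Lemma jsharp_conj p q j : p * q = 1 -> q * p = 1 ->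
  jsharp R j -> jsharp R (p * j * q).
Proof.
move=> pq qp [n n1 Jj]; exists n => //; rewrite conjX //.
by apply: jacobsonMr; exact: jacobsonMl.
Qed.

Lemma ring_similar_sym a b : ring_similar a b -> ring_similar b a.
Proof.
move=> [p [q [pq qp ->]]]; exists q, p; split=> //.
by rewrite !mulrA qp mul1r -mulrA qp mulr1.
Qed.

Lemma strongly_jsharp_clean_similar a b : ring_similar a b ->
  strongly_jsharp_clean a -> strongly_jsharp_clean b.
Proof.
move=> [p [q [pq qp ->]]] [e [j [-> ee Jj ej]]].
exists (p * e * q), (p * j * q); split.
- by rewrite mulrDr mulrDl.
- by rewrite conjX // ee.
- exact: jsharp_conj.
- by rewrite !conjM // ej.
Qed.

(** Both [e * u] and [u * f] equal [e * f] for the element [u] below. *)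
Lemma idempotent_similar e f : e * e = e -> f * f = f ->
  invertible (e * f + (1 - e) * (1 - f)) -> ring_similar e f.
Proof.
move=> ee ff [v [uv vu]]; set u := _ + _ in uv vu.
exists v, u; split=> //.
have eu : e * u = e * f.
  by rewrite mulrDr !mulrA (mulrBr e) ee mulr1 subrr mul0r addr0.
have uf : u * f = e * f.
  by rewrite mulrDl -!mulrA (mulrBl f 1) ff mul1r subrr mulr0 addr0.
by rewrite -mulrA eu -uf mulrA vu mul1r.
Qed.

End Similarity.

(** * Local rings *)

Section Local.
Variables (R : pzRingType) (hR : local_ring R).
Implicit Types x : R.

Lemma local_jacobson1 : ~ jacobson R 1.
Proof.
by case: hR => M [maxM _] J1; apply: (maximal_left_ideal1 maxM); exact: J1.
Qed.

(** Outside the radical, [R * x] lies in no maximal left ideal, so [x] has a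
left inverse; this left inverse is again outside the radical. *)
Lemma local_invertible x : ~ jacobson R x -> invertible x.
Proof.
have linv y : ~ jacobson R y -> exists w, w * y = 1.
  move=> nJy; apply: contrapT => nlinv; apply: nJy => N maxN.
  have [|M maxM subM] := left_ideal_sub_maximal (left_ideal_principal y).
    by move=> [w _ ww]; apply: nlinv; exists w.
  case: hR => M0 [_ uniqM]; rewrite -(uniqM N maxN) (uniqM M maxM).
  by apply: subM; exists 1; rewrite ?mul1r.
move=> nJx; have [w wx] := linv x nJx.
have nJw : ~ jacobson R w.
  by move=> Jw; apply: local_jacobson1; rewrite -wx; exact: jacobsonMr.
have [v vw] := linv w nJw; exists w; split=> //.
by rewrite -[x]mul1r -{1}vw -(mulrA v) wx mulr1.
Qed.

Lemma local_invertibleVsub1 x : invertible x \/ invertible (1 - x).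
Proof.
have [Jx|nJx] := pselect (jacobson R x).
  by right; exact: jacobson_invertible.
by left; exact: local_invertible.
Qed.

Lemma local_jsharp x : jsharp R x -> jacobson R x.
Proof.
move=> [n _ Jxn]; apply: contrapT => /local_invertible[y [xy yx]].
have yxn : y ^+ n * x ^+ n = 1.
  by rewrite -exprMn_comm ?yx ?expr1n // /GRing.comm xy.
by apply: local_jacobson1; rewrite -yxn; exact: jacobsonMl.
Qed.

End Local.

(** * The ring of twisted matrices *)

Section TwistedMatrices.
Variables (R : pzRingType) (s : R) (hs : central s).
Implicit Types (A e : Kmx hs) (a b c d p q x y : R).

Local Notation mkK := (mkK hs).

Lemma mkK_eta A : A = mkK (A 0 0) (A 0 1) (A 1 0) (A 1 1).
Proof. by apply: KmxP; rewrite !mkKE. Qed.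

Lemma mkK_inj a b c d a' b' c' d' : mkK a b c d = mkK a' b' c' d' ->
  [/\ a = a', b = b', c = c' & d = d'].
Proof.
move=> E; have E' i j : mkK a b c d i j = mkK a' b' c' d' i j by rewrite E.
by have := (E' 0 0, E' 0 1, E' 1 0, E' 1 1); rewrite !mkKE => -[[[]]].
Qed.

Lemma mkKN a b c d : - mkK a b c d = mkK (- a) (- b) (- c) (- d).
Proof. by apply/eqP; rewrite eq_sym -addr_eq0 mkKD !addNr; apply/eqP;
  apply: KmxP; rewrite !mkKE !mxE. Qed.

Lemma mkK_diagX p q n : mkK p 0 0 q ^+ n = mkK (p ^+ n) 0 0 (q ^+ n).
Proof.
elim: n => [//|n IHn].
by rewrite !exprS IHn mkKM !(mulr0, mul0r, addr0, add0r).
Qed.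

(** Block elimination: the matrix is lower unitriangular times
[diag(u, v - s * c * u' * b)] times upper unitriangular. *)
Lemma invertible_schur u u' b c v : u * u' = 1 -> u' * u = 1 ->
  invertible (v - s * c * u' * b) -> invertible (mkK u b c v).
Proof.
move=> uu' u'u [t' [tt' t't]].
set t := v - _ in tt' t't.
have -> : mkK u b c v = mkK 1 0 (c * u') 1 * mkK u 0 0 t * mkK 1 (u' * b) 0 1.
  rewrite !mkKM !(mulr0, mul0r, mulr1, mul1r, addr0, add0r) -!mulrA u'u mulr1.
  rewrite (mulrA u u') uu' mul1r.
  by rewrite /t addrC -!mulrA subrK.
apply: invertibleM; first apply: invertibleM.
- exists (mkK 1 0 (- (c * u')) 1).
  by split; rewrite mkKM !(mulr0, mul0r, mulr1, mul1r, addr0, add0r, subrr, addNr).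
- exists (mkK u' 0 0 t').
  by split; rewrite mkKM !(mulr0, mul0r, addr0, add0r) ?uu' ?u'u ?tt' ?t't.
- exists (mkK 1 (- (u' * b)) 0 1).
  by split; rewrite mkKM !(mulr0, mul0r, mulr1, mul1r, addr0, add0r, subrr, addNr).
Qed.

(** If [p] and [q] lie in the radical, then [1 - Y * diag(p, q)] is congruent
to [1] modulo the radical entrywise, so elimination inverts it. *)
Lemma jacobson_diagP p q :
  jacobson (Kmx hs) (mkK p 0 0 q) <-> jacobson R p /\ jacobson R q.
Proof.
split=> [/jacobsonP Jpq|[Jp Jq]].
  split; apply/jacobsonP => y.
  - have [W] := Jpq (mkK y 0 0 0).
    rewrite (mkK_eta W) mkKM -mkK1 mkKN mkKD mkKM.
    move=> /mkK_inj[E _ _ _]; exists (W 0 0); rewrite -[RHS]E.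
    by rewrite !(mulr0, mul0r, addr0, add0r, oppr0).
  - have [W] := Jpq (mkK 0 0 0 y).
    rewrite (mkK_eta W) mkKM -mkK1 mkKN mkKD mkKM.
    move=> /mkK_inj[_ _ _ E]; exists (W 1 1); rewrite -[RHS]E.
    by rewrite !(mulr0, mul0r, addr0, add0r, oppr0).
apply/jacobsonP => Y.
suff [Z [_ ZE]] : invertible (1 - Y * mkK p 0 0 q) by exists Z.
rewrite (mkK_eta Y) mkKM -mkK1 mkKN mkKD !(mulr0, addr0, add0r).
have [u' [uu' u'u]] := jacobson_invertible (jacobsonMl (Y 0 0) Jp).
apply: (invertible_schur uu' u'u).
rewrite -addrA -opprD; apply: jacobson_invertible.
apply: jacobsonD; first exact: jacobsonMl.
by apply: jacobsonMl; apply: jacobsonN; exact: jacobsonMl.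
Qed.

Lemma mkK_comm_diag10 A : mkK 1 0 0 0 * A = A * mkK 1 0 0 0 ->
  A = mkK (A 0 0) 0 0 (A 1 1).
Proof.
rewrite {1 2}(mkK_eta A) !mkKM !(mulr0, mul0r, mulr1, mul1r, addr0, add0r).
by move=> /mkK_inj[_ A01 A10 _]; rewrite [LHS]mkK_eta A01 -A10.
Qed.

Lemma sub1_diag p q : 1 - mkK p 0 0 q = mkK (1 - p) 0 0 (1 - q).
Proof. by rewrite -mkK1 mkKN mkKD !oppr0 !addr0. Qed.

(** This is the intertwiner of [idempotent_similar] for [f = diag(1, 0)]: right
multiplication by [f] and [1 - f] selects columns. *)
Lemma diag10_mix a b c d :
  mkK a b c d * mkK 1 0 0 0 + (1 - mkK a b c d) * (1 - mkK 1 0 0 0) =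
  mkK a (- b) c (1 - d).
Proof.
rewrite sub1_diag mkKM -mkK1 mkKN [mkK 1 0 0 1 + _]mkKD mkKM mkKD.
by rewrite !(subrr, subr0, mulr0, mul0r, mulr1, addr0, add0r).
Qed.

(** The Schur complement [t] of [e] and that of the intertwiner of [e] with
[diag(1, 0)] add up to [1], so one of the two matrices is invertible. *)
Lemma local_Kmx_idempotent_unit00 e : local_ring R -> e * e = e ->
  invertible (e 0 0) -> e = 1 \/ ring_similar e (mkK 1 0 0 0).
Proof.
move=> hR ee [a' [aa' a'a]].
pose t := e 1 1 - s * e 1 0 * a' * e 0 1.
have [tU|tU] := local_invertibleVsub1 hR t.
  left; have [e' [ee' _]] : invertible e.
    by rewrite (mkK_eta e); exact: (invertible_schur aa' a'a).
  by rewrite -ee' -{2}ee -mulrA ee' mulr1.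
right; apply: idempotent_similar => //.
  by rewrite mkKM !(mulr0, mul0r, mulr1, addr0, add0r).
rewrite (mkK_eta e) diag10_mix.
apply: (invertible_schur aa' a'a).
by rewrite mulrN opprK -addrA [- _ + _]addrC -opprB.
Qed.

(** One of [e 0 0] and [1 - e 0 0] is invertible, and [1 - e 0 0] is the upper
left entry of the idempotent [1 - e]. *)
Lemma local_Kmx_idempotent e : local_ring R -> e * e = e ->
  [\/ e = 0, e = 1, ring_similar e (mkK 1 0 0 0)
    | ring_similar (1 - e) (mkK 1 0 0 0)].
Proof.
move=> hR ee; have [aU|aU] := local_invertibleVsub1 hR (e 0 0).
  have [->|] := local_Kmx_idempotent_unit00 hR ee aU.
    exact: Or42.
  exact: Or43.
have [||e1|] := @local_Kmx_idempotent_unit00 (1 - e) hR.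
- by rewrite mulrBl mul1r mulrBr mulr1 ee subrr subr0.
- by rewrite (mkK_eta e) -mkK1 mkKN mkKD mkKE.
- by apply: Or41; rewrite -[e](subKr 1) e1 subrr.
- exact: Or44.
Qed.

Lemma local_jsharp_comm_diag10 A : local_ring R -> jsharp (Kmx hs) A ->
  mkK 1 0 0 0 * A = A * mkK 1 0 0 0 ->
  exists x y, [/\ A = mkK x 0 0 y, jacobson R x & jacobson R y].
Proof.
move=> hR [n n1 JA] /mkK_comm_diag10 EA; exists (A 0 0), (A 1 1).
rewrite EA mkK_diagX in JA; have [Jx Jy] := (jacobson_diagP _ _).1 JA.
by split=> //; apply: local_jsharp => //; exists n.
Qed.

End TwistedMatrices.

Theorem theorem4p5 (R : pzRingType) (hR : local_ring R)
    (s : R) (hs : central s) (A : Kmx hs) :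
  strongly_jsharp_clean A <->
  [\/ jsharp (Kmx hs) A,
      [set 1 + z | z in jsharp (Kmx hs)] A
    | exists a b : R, ring_similar A (mkK hs a 0 0 b) /\
        ((jacobson R a /\ [set 1 + z | z in jacobson R] b) \/
         (jacobson R b /\ [set 1 + z | z in jacobson R] a))].
Proof.
split.
  move=> [e [j [-> ee Jj ej]]]; rewrite expr2 in ee.
  have [e0|e1|[p [q [pq qp fE]]]|[p [q [pq qp fE]]]] :=
    local_Kmx_idempotent hR ee.
  - by apply: Or31; rewrite e0 add0r.
  - by apply: Or32; exists j; rewrite ?e1.
  - have [|x [y [E Jx Jy]]] :=
      local_jsharp_comm_diag10 hR (jsharp_conj pq qp Jj).
      by rewrite fE !conjM // ej.
    apply: Or33; exists (1 + x), y; split.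
      by exists p, q; split; rewrite // mulrDr mulrDl -fE E mkKD !addr0 add0r.
    by right; split=> //; exists x.
  - have [|x [y [E Jx Jy]]] :=
      local_jsharp_comm_diag10 hR (jsharp_conj pq qp Jj).
      by rewrite fE !conjM // (mulrBl j) (mulrBr j) ej mul1r mulr1.
    have peq : p * e * q = mkK hs 0 0 0 1.
      rewrite -[e](subKr 1) mulrBr mulrBl -fE mulr1 pq sub1_diag.
      by rewrite subrr subr0.
    apply: Or33; exists x, (1 + y); split.
      by exists p, q; split; rewrite // mulrDr mulrDl peq E mkKD !addr0 add0r.
    by left; split=> //; exists y.
case=> [JA|[z Jz <-]|[a [b [simA ab]]]].
- by exists 0, A; rewrite add0r expr0n mul0r mulr0.
- by exists 1, z; rewrite expr1n mul1r mulr1.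
apply: (strongly_jsharp_clean_similar (ring_similar_sym simA)).
case: ab => [[Ja [z Jz <-]]|[Jb [z Jz <-]]].
- exists (mkK hs 0 0 0 1), (mkK hs a 0 0 z); split.
  + by rewrite mkKD !add0r.
  + by rewrite mkK_diagX expr1n expr0n.
  + by exists 1 => //; rewrite expr1; apply/jacobson_diagP.
  + by rewrite !mkKM !(mulr0, mul0r, mulr1, mul1r, addr0, add0r).
- exists (mkK hs 1 0 0 0), (mkK hs z 0 0 b); split.
  + by rewrite mkKD !add0r.
  + by rewrite mkK_diagX expr1n expr0n.
  + by exists 1 => //; rewrite expr1; apply/jacobson_diagP.
  + by rewrite !mkKM !(mulr0, mul0r, mulr1, mul1r, addr0, add0r).
Qed.
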